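(* Let $X$ be a connected Alexandroff paratopological group and let $G$ be a topological group. If $f\colon X\to G$ is a continuous epimorphism (respectively, a continuous monomorphism), then $G$ carries the trivial topology. In particular, there is no continuous isomorphism from $X$ onto $G$ unless $G$ carries the trivial topology.
   Context: An Alexandroff space is a topological space in which arbitrary intersections of open sets are open. A paratopological group is a group endowed with a topology for which the multiplication map is continuous (inversion need not be continuous). A topological group is a group endowed with a topology for which both multiplication and inversion are continuous. No separation axioms are assumed. An Alexandroff paratopological group is a paratopological group whose topology is Alexandroff. An epimorphism (monomorphism, isomorphism) is a surjective (injective, bijective) group homomorphism. The trivial topology is the indiscrete one, whose only open sets are the empty set and the whole space.
   Formalization: For a continuous monomorphism the conclusion is that the image f(X), as a subspace of G, carries the trivial topology; the claim for all of G fails, e.g. for X the one-element group and G = Z/2 discrete. *)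

(* Defs.v *)
From HB Require Import structures.
From mathcomp Require Import all_boot all_algebra.
From mathcomp Require Import all_classical all_reals all_analysis.

Set Implicit Arguments.
Unset Strict Implicit.
Unset Printing Implicit Defensive.

Local Open Scope classical_set_scope.
Local Open Scope group_scope.

(* The library's topological groups (tvs) are additive, hence abelian; the
   groups here are arbitrary, so the multiplicative hierarchy is used. *)
HB.structure Definition PreTopologicalGroup := {G of Topological G & Group G}.

HB.mixin Record PreTopologicalGroup_isParatopologicalGroup G
    & PreTopologicalGroup G := {
  mulg_continuous : continuous (fun x : G * G => x.1 * x.2)
}.

#[short(type="paratopologicalGroupType")]
HB.structure Definition ParatopologicalGroup :=
  {G of PreTopologicalGroup G & PreTopologicalGroup_isParatopologicalGroup G}.

HB.mixin Record ParatopologicalGroup_isTopologicalGroup G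
    & PreTopologicalGroup G := {
  invg_continuous : continuous (fun x : G => x^-1)
}.

#[short(type="topologicalGroupType")]
HB.structure Definition TopologicalGroup :=
  {G of ParatopologicalGroup G & ParatopologicalGroup_isTopologicalGroup G}.

Definition alexandroff (T : topologicalType) :=
  forall F : set (set T), F `<=` open -> open (\bigcap_(A in F) A).

Definition trivial_topology (T : topologicalType) :=
  @open T = [set set0; setT].

(* Main.v *)
(** Call [x] and [y] equivalent when every open set of [G] containing [f x]
    contains [f y]. The class of [x] is an intersection of preimages of open
    sets, hence open since [X] is Alexandroff. In a topological group the
    relation is symmetric, so the classes partition [X] into open sets, and
    connectedness leaves only one. *)
Require Import Defs.
From HB Require Import structures.
From mathcomp Require Import all_boot all_algebra.
From mathcomp Require Import all_classical all_reals all_analysis.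

Local Open Scope classical_set_scope.

Lemma mulgl_continuous (G : paratopologicalGroupType) (a : G) :
  continuous (fun x : G => (a * x)%g).
Proof.
move=> x.
apply: (@continuous_comp _ _ _ (pair a) (fun z : G * G => z.1 * z.2)%g).
  by apply: cvg_pair; [exact: cvg_cst|exact: cvg_id].
exact: mulg_continuous.
Qed.

Lemma mulgr_continuous (G : paratopologicalGroupType) (a : G) :
  continuous (fun x : G => (x * a)%g).
Proof.
move=> x.
apply: (@continuous_comp _ _ _ (pair^~ a) (fun z : G * G => z.1 * z.2)%g).
  by apply: cvg_pair; [exact: cvg_id|exact: cvg_cst].
exact: mulg_continuous.
Qed.

Lemma topological_group_R0 (G : topologicalGroupType) (a b : G) :
  (forall W : set G, open W -> W a -> W b) ->
  forall W : set G, open W -> W b -> W a.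
Proof.
move=> ab W oW Wb.
(* The homeomorphism [g |-> b g^-1 a] exchanges [a] and [b]. *)
pose h (g : G) := (b * (g^-1 * a))%g.
have hc : continuous h.
  move=> g; apply: (@continuous_comp _ _ _ (fun x : G => (x^-1 * a)%g)
                      (fun x : G => (b * x)%g)); last exact: mulgl_continuous.
  apply: (@continuous_comp _ _ _ (fun x : G => (x^-1)%g)
                      (fun x : G => (x * a)%g)); last exact: mulgr_continuous.
  exact: invg_continuous.
have := ab (h @^-1` W) (open_comp (fun g _ => hc g) oW).
by rewrite /h /preimage /= mulVg mulg1 mulVKg; apply.
Qed.

Lemma connected_alexandroff_image (X : topologicalType)
    (G : topologicalGroupType) (f : X -> G) :
  alexandroff X -> connected [set: X] -> continuous f ->
  forall W : set G, open W -> forall x y, W (f x) -> W (f y).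
Proof.
move=> alexX connX fc W oW x y Wfx.
pose cl z := [set t | forall V : set G, open V -> V (f z) -> V (f t)].
have cl_open z : open (cl z).
  have -> : cl z = \bigcap_(A in [set f @^-1` V | V in [set V | open V /\ V (f z)]]) A.
    apply/seteqP; split=> t /=.
      by move=> zt _ [V [oV Vz] <-]; exact: zt.
    by move=> zt V oV Vz; apply: (zt (f @^-1` V)); exists V.
  by apply: alexX => _ [V [oV _] <-]; apply: open_comp.
have cl_closed : closed (cl x).
  rewrite -openC.
  (* The complement is a union of open classes: if [t] lay in both [cl z] and [cl x], symmetry would
     lead from [f t] back to [f z], putting [z] in [cl x]. *)
  have -> : ~` cl x = \bigcup_(z in ~` cl x) cl z.
    apply/seteqP; split=> t; first by move=> xt; exists t.
    move=> [z xz zt] xt; apply: xz => V oV Vx.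
    exact: (topological_group_R0 _ _ _ zt V oV) (xt V oV Vx).
  exact: bigcup_open.
have clT : cl x = setT.
  (* [connected] makes a nonempty set equal to the space once it is the trace of an open set and of
     a closed set; [cl x] serves as both. *)
  apply: connX; first by exists x.
  - by exists (cl x); rewrite ?setTI.
  - by exists (cl x); rewrite ?setTI.
have : cl x y by rewrite clT.
exact.
Qed.

(** Puts triviality in the pointwise form that [connected_alexandroff_image] delivers. *)
Lemma trivial_topologyP (T : topologicalType) :
  trivial_topology T <->
  forall W : set T, open W -> forall x y, W x -> W y.
Proof.
rewrite /trivial_topology; split=> [oT W|WT].
  by rewrite oT => -[] ->.
apply/seteqP; split=> W /=; last first.
  by move=> [] ->; [exact: open0|exact: openT].
move=> oW; have [->|/set0P[x Wx]] := eqVneq W set0; [by left|right].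
by apply/seteqP; split=> // y _; exact: (WT W oW x).
Qed.

(* For injective f the trivial topology is that of the image, as a subspace of
   G: when X is the one-element group, f is injective whatever G is. *)
Theorem corollary3p5 (X : paratopologicalGroupType) (G : topologicalGroupType)
    (alexX : alexandroff X) (connX : connected [set: X]) :
  [/\ forall f : {multiplicative X -> G},
        continuous f -> set_surj [set: X] [set: G] f -> trivial_topology G,
      forall f : {multiplicative X -> G},
        continuous f -> injective f -> trivial_topology (set_type (range f))
    & ~ trivial_topology G ->
      ~ exists f : {multiplicative X -> G},
          continuous f /\ set_bij [set: X] [set: G] f].
Proof.
(* Proved first because the bijective case also reduces to it. *)
have surj (f : {multiplicative X -> G}) :
    continuous f -> set_surj [set: X] [set: G] f -> trivial_topology G.
  move=> fc fs; apply/trivial_topologyP => W oW a b.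
  have [x _ <-] := fs a I; have [y _ <-] := fs b I.
  exact: connected_alexandroff_image.
split=> // [f fc _|Gnt [f [fc [_ _ fs]]]]; last exact: Gnt (surj f fc fs).
(* Open sets of the subspace are preimages of open sets [V] of [G] under the inclusion, so the claim
   concerns [V] at two values of [f]. *)
apply/trivial_topologyP => _ [V oV <-] [a fa] [b fb].
rewrite /preimage /= !set_valE /=.
have [x _ <-] := set_mem fa; have [y _ <-] := set_mem fb.
exact: connected_alexandroff_image.
Qed.
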